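(* Let $(m_n)_{n\ge 2}$ be a sequence of positive integers, write $m=m_n$ and $p=p_n:=n^{-2}$, and for each $n$ let $X=(X_{ij})_{1\le i,j\le n}$ be a random matrix with joint multinomial distribution $\mathcal{M}(m,n^2)$. Assume that $$\frac{mp}{\log n}\to 0\quad\text{as } n\to\infty,$$ and that for every $\delta>0$ one has $mp\gg n^{-\delta}$, i.e. $mp\,n^{\delta}\to\infty$ as $n\to\infty$. Then, as $n\to\infty$, $$\mathbb{E}\max_{\sigma\in\mathcal{S}_n}\sum_{i=1}^n X_{i\sigma(i)}=\frac{n\log n}{\log\left(\frac{\log n}{mp}\right)}\,(1+o(1)).$$
   Context: $\mathcal{S}_n$ denotes the group of permutations of $\{1,\dots,n\}$. $\mathcal{M}(m,N)$ denotes the multinomial law with $m$ trials and $N$ equiprobable cells: it is the law of the vector of cell counts when $m$ particles are thrown independently and uniformly into $N$ cells. Under $\mathcal{M}(m,n^2)$ the cells are the $n^2$ positions $(i,j)$ of the matrix, so each $X_{ij}$ has the binomial distribution with $m$ trials and success probability $p=n^{-2}$, and $\sum_{i,j}X_{ij}=m$. *)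

(* Defs.v *)
(* MathComp / MathComp-Analysis *)
From HB Require Import structures.
From mathcomp Require Export all_boot all_order all_algebra all_fingroup.
From mathcomp Require Export all_classical all_reals all_analysis.

Set Implicit Arguments.
Unset Strict Implicit.
Unset Printing Implicit Defensive.

Import Order.TTheory GRing.Theory Num.Theory.
Import numFieldNormedType.Exports.

Local Open Scope classical_set_scope.
Local Open Scope ring_scope.

Definition cell_counts (m : nat) (C : finType) (f : {ffun 'I_m -> C}) :
    {ffun C -> nat} :=
  [ffun c => #|[set a : 'I_m | f a == c]%SET|].

(* Throwing m particles independently and uniformly into the cells of C amounts
   to choosing f : 'I_m -> C uniformly among all #|C| ^ m such functions.  This
   is the probability that the resulting cell counts are k, that is, the mass
   at k of the multinomial law M(m, #|C|). *)
Definition multinomial_pmf (R : realType) (m : nat) (C : finType)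
    (k : {ffun C -> nat}) : R :=
  #|[set f : {ffun 'I_m -> C} | cell_counts f == k]%SET|%:R / (#|C| ^ m)%N%:R.

(* The joint law of the family X is M(m, #|C|); since {ffun C -> nat} is
   countable, the law is determined by its point masses. *)
Definition has_multinomial_law (R : realType) (d : measure_display)
    (T : measurableType d) (P : probability T R) (m : nat) (C : finType)
    (X : C -> {RV P >-> nat}) : Prop :=
  forall k : {ffun C -> nat},
    P [set t | forall c, X c t = k c] = (multinomial_pmf R m k)%:E.

Definition max_assignment (n : nat) (x : 'I_n * 'I_n -> nat) : nat :=
  (\max_(s : 'S_n) \sum_(i < n) x (i, s i))%N.

(* Main.v *)
Require Import Defs.
From mathcomp Require Import zify ring lra measurable_realfun.

(** Write N = n^2, lam = m / N, L = log n and u = log (L / lam), so that the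
    claimed order of magnitude is n L / u.  The first assumption says that u
    tends to infinity, and the second one that u = o(L); hence L / u also tends
    to infinity.  Since only finitely many count matrices have positive mass,
    the expectation is the plain average of max_assignment (cell_counts f) over
    all maps f from the m particles to the N cells (expectation_multinomial),
    and everything else is finite combinatorics about this average.

    Upper bound.  An assignment picks one entry per row, and any entry y
    satisfies y <= t + exp (s (y - t)) / s.  Summing this over the chosen
    entries and enlarging the sum of exponentials to all cells removes the
    maximum (max_assignment_le_expR).  The moment generating function of a cell
    count is at most exp (lam exp s), and the value of t that makes the
    exponential sum contribute n / s gives the bound n (L + lam exp s + 1) / s
    (mean_max_assignment_le).  With s = (1 - e) u one has
    lam exp s = L exp (- e u) = o(L).

    Lower bound.  Reserve a set J of k, about e n, columns, and treat the other
    n - k rows one by one, giving each the best column still available; there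
    are always more than k of these.  Once the rows of the particles are fixed,
    their columns are independent and uniform, so different rows are
    independent, and the columns of a row are exchangeable.  Therefore each row
    collects on average at least what it would find in J, and the conditioning
    on the rows can be undone row by row, leaving the average of the maximum of
    the k cells of a row that lie in J (mean_max_assignment_ge).
    Independence of the rows is used in the form of the resampling identity
    mean_merge.  That maximum is at least h, the integer part of (1 - e) L / u,
    with probability close to 1, by the second moment method applied to the
    number of these cells with exactly h particles (mean_bigmax_ge): a cell
    has h particles with probability at least
    exp (- u h - 2 lam) >= n^(-1+e) exp (- 2 lam) (binom_mass_ge), so the
    expected number of such cells tends to infinity, while the cells are
    pairwise almost negatively correlated. *)

Set Implicit Arguments.
Unset Strict Implicit.
Unset Printing Implicit Defensive.

Import Order.TTheory GRing.Theory Num.Theory.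
Import numFieldNormedType.Exports.

Local Open Scope classical_set_scope.
Local Open Scope ring_scope.

(** * Averages over finite types *)

Section Mean.
Variable R : realFieldType.

Definition mean (T : finType) (F : T -> R) : R := (\sum_x F x) / #|T|%:R.

Lemma eq_mean (T : finType) (F G : T -> R) : F =1 G -> mean F = mean G.
Proof. by move=> FG; rewrite /mean (eq_bigr _ (fun x _ => FG x)). Qed.

Lemma ler_mean (T : finType) (F G : T -> R) :
  (forall x, F x <= G x) -> mean F <= mean G.
Proof. by move=> FG; rewrite ler_wpM2r ?invr_ge0 ?ler0n// ler_sum. Qed.

Lemma meanD (T : finType) (F G : T -> R) :
  mean (fun x => F x + G x) = mean F + mean G.
Proof. by rewrite /mean big_split mulrDl. Qed.

Lemma meanZ (T : finType) (a : R) (F : T -> R) :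
  mean (fun x => a * F x) = a * mean F.
Proof. by rewrite /mean -mulr_sumr mulrA. Qed.

Lemma mean_sum (T I : finType) (Q : pred I) (F : I -> T -> R) :
  mean (fun x => \sum_(i | Q i) F i x) = \sum_(i | Q i) mean (F i).
Proof. by rewrite /mean exchange_big mulr_suml. Qed.

Lemma mean_const (T : finType) (a : R) : (0 < #|T|)%N -> mean (fun _ : T => a) = a.
Proof.
move=> T0; rewrite /mean sumr_const -[a *+ _]mulr_natr mulfK//.
by rewrite pnatr_eq0 -lt0n.
Qed.

Lemma mean_reindex (T : finType) (f : T -> T) (F : T -> R) :
  injective f -> mean F = mean (F \o f).
Proof. by move=> /injF_bij fb; rewrite /mean (reindex f)//; exact: onW_bij. Qed.

Lemma mean_ge (T : finType) (a : R) (F : T -> R) :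
  (0 < #|T|)%N -> (forall x, a <= F x) -> a <= mean F.
Proof. by move=> T0 aF; rewrite -[leLHS](mean_const _ T0) ler_mean. Qed.

Definition merge (D E : finType) (A : {set D}) (h h' : {ffun D -> E}) :=
  [ffun a => if a \in A then h a else h' a].

(** A uniform function stays uniform when its values outside A are redrawn
    independently.  The reason is that (h, h') |-> (merge A h h', merge A h' h)
    is an involution on pairs of functions.  This expresses the independence of
    the restrictions to A and to its complement without ever restricting
    functions to subsets. *)
Lemma mean_merge (D E : finType) (A : {set D}) (F : {ffun D -> E} -> R) :
  mean F = mean (fun h => mean (fun h' => F (merge A h h'))).
Proof.
have [T0|T0] := eqVneq (#|{ffun D -> E}|%:R : R) 0.
  by rewrite /mean T0 invr0 !mulr0.
rewrite /mean -mulr_suml pair_bigA/=.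
pose w (p : {ffun D -> E} * {ffun D -> E}) := (merge A p.1 p.2, merge A p.2 p.1).
have wK : involutive w.
  by case=> h h'; rewrite /w/=; congr pair; apply/ffunP => a;
    rewrite !ffunE/=; case: ifP => ->.
rewrite (reindex_inj (inv_inj wK))/=.
under [X in _ = X / _ / _]eq_bigr => p _.
  have -> : merge A (merge A p.1 p.2) (merge A p.2 p.1) = p.1.
    by have := congr1 fst (wK p).
  over.
rewrite -(pair_bigA _ (fun h (_ : {ffun D -> E}) => F h))/=.
under [X in _ = X / _ / _]eq_bigr do rewrite sumr_const -[_ *+ _]mulr_natr.
by rewrite -mulr_suml mulfK.
Qed.

(** Particles thrown uniformly into a grid have independent uniform rows and
    columns. *)
Lemma mean_pair (D E1 E2 : finType) (F : {ffun D -> E1 * E2} -> R) :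
  mean F = mean (fun g : {ffun D -> E1} => mean (fun h : {ffun D -> E2} =>
    F [ffun a => (g a, h a)])).
Proof.
rewrite /mean -mulr_suml pair_bigA/= -mulrA -invfM -natrM.
congr (_ / _%:R); last by rewrite !card_ffun card_prod expnMn mulnC.
pose u (f : {ffun D -> E1 * E2}) := ([ffun a => (f a).1], [ffun a => (f a).2]).
rewrite (reindex (fun p : {ffun D -> E1} * {ffun D -> E2} =>
   [ffun a => (p.1 a, p.2 a)]))//.
exists u => [[g h] _|f _]; last by apply/ffunP => a; rewrite !ffunE -surjective_pairing.
by congr pair; apply/ffunP => a; rewrite !ffunE.
Qed.

End Mean.

(** * Greedy assignments *)

Section Greedy.
Variable n : nat.
Implicit Types (x y : 'I_n * 'I_n -> nat) (rs : seq 'I_n) (J : {set 'I_n}).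

Definition best_col x (i : 'I_n) J : 'I_n :=
  [arg max_(j > odflt i [pick j in J] in J) x (i, j)].

Lemma best_colP x i J : (0 < #|J|)%N ->
  best_col x i J \in J /\ x (i, best_col x i J) = (\max_(j in J) x (i, j))%N.
Proof.
move=> /card_gt0P[j0 j0J].
have dJ : odflt i [pick j in J] \in J by case: pickP => [//|/(_ j0)]; rewrite j0J.
rewrite /best_col; case: arg_maxnP => // j jJ jmax; split => //.
apply/eqP; rewrite eqn_leq; apply/andP; split.
  by rewrite (bigop.bigmax_sup j).
by apply/bigop.bigmax_leqP => k kJ; exact: jmax.
Qed.

Fixpoint greedy x rs J : nat :=
  if rs is i :: rs' then
    (x (i, best_col x i J) + greedy x rs' (J :\ best_col x i J))%N
  else 0.

(** The greedy choice is injective, so it extends to a permutation.  In the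
    induction step, composing with the transposition of s i and j redirects row
    i to its column j without disturbing the rows served later: their columns
    avoid j, and differ from s i by injectivity. *)
Lemma greedy_perm x rs J : uniq rs -> (size rs <= #|J|)%N ->
  exists s : 'S_n, (forall i, i \in rs -> s i \in J) /\
    greedy x rs J = (\sum_(i <- rs) x (i, s i))%N.
Proof.
elim: rs J => [|i rs IH] J /=; first by exists 1%g; split => //; rewrite big_nil.
move=> /andP[irs urs] szJ.
have [jJ _] := best_colP x i (leq_ltn_trans (leq0n _) szJ).
move: (best_col x i J) jJ => j jJ.
have [|s [sJ sE]] := IH (J :\ j) urs.
  by move: szJ; rewrite (cardsD1 j) jJ.
exists (s * tperm (s i) j)%g.
have sD k : k \in rs -> (s * tperm (s i) j)%g k = s k.
  move=> krs; rewrite permM tpermD//.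
    by rewrite (inj_eq perm_inj); apply: contraNneq irs => ->.
  by move: (sJ _ krs); rewrite !inE eq_sym => /andP[].
split => [k|].
  rewrite inE => /predU1P[->|krs]; first by rewrite permM tpermL.
  by rewrite sD//; move: (sJ _ krs); rewrite !inE => /andP[].
rewrite big_cons permM tpermL; congr addn.
by rewrite sE; apply: eq_big_seq => k krs; rewrite sD.
Qed.

Lemma greedy_le_max_assignment x rs J :
  uniq rs -> (size rs <= #|J|)%N -> (greedy x rs J <= max_assignment x)%N.
Proof.
move=> urs szJ; have [s [_ ->]] := greedy_perm x urs szJ.
rewrite /max_assignment (bigop.bigmax_sup s)//.
by rewrite big_uniq//= big_mkcond leq_sum// => i _; case: ifP.
Qed.

Lemma eq_best_col x y i J : (forall j, x (i, j) = y (i, j)) ->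
  best_col x i J = best_col y i J.
Proof.
move=> xy; rewrite /best_col; congr odflt.
apply: eq_pick => j /=; congr andb.
by apply: eq_forallb => k; rewrite !xy.
Qed.

Lemma eq_greedy x y rs J : (forall i j, i \in rs -> x (i, j) = y (i, j)) ->
  greedy x rs J = greedy y rs J.
Proof.
elim: rs J => [//|i rs IH] J /= xy.
have xyi j : x (i, j) = y (i, j) by apply: xy; rewrite mem_head.
rewrite (eq_best_col J xyi) xyi IH// => k j krs.
by apply: xy; rewrite inE krs orbT.
Qed.

(** The permutation found by the greedy algorithm on the zero matrix. *)
Lemma perm_subset (J J' : {set 'I_n}) : (#|J| <= #|J'|)%N ->
  exists s : 'S_n, forall j, j \in J -> s j \in J'.
Proof.
move=> JJ'; have [||s [sJ _]] := @greedy_perm (fun=> 0) (enum J) J'.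
- exact: enum_uniq.
- by rewrite -cardE.
by exists s => j jJ; apply: sJ; rewrite mem_enum.
Qed.

End Greedy.

(** * The average value of the greedy assignment *)

Section GreedyMean.
Variables (R : realFieldType) (m n : nat).
Implicit Types (g h : {ffun 'I_m -> 'I_n}) (J : {set 'I_n}).

(** The map g gives the row of each particle and h its column. *)
Definition counts g h : {ffun 'I_n * 'I_n -> nat} :=
  cell_counts [ffun a => (g a, h a)].

Lemma countsE g h i j :
  counts g h (i, j) = #|[set a | (g a == i) && (h a == j)]%SET|.
Proof. by rewrite ffunE; apply: eq_card => a; rewrite !inE ffunE. Qed.

Definition row_max g i J h : R := (\max_(j in J) counts g h (i, j))%N%:R.

(** For fixed rows the columns are exchangeable: relabelling them by a
    permutation that maps J into J' preserves the uniform law of h and sends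
    the maximum over J below a maximum over J'. *)
Lemma mean_row_max_le_card g i J J' : (#|J| <= #|J'|)%N ->
  mean (row_max g i J) <= mean (row_max g i J').
Proof.
move=> /perm_subset[s sJ].
pose sg h : {ffun 'I_m -> 'I_n} := [ffun a => s (h a)].
rewrite (@mean_reindex _ _ sg (row_max g i J')); last first.
  move=> h h' /ffunP hh; apply/ffunP => a.
  by have := hh a; rewrite !ffunE => /perm_inj.
apply: ler_mean => h; rewrite /row_max/= ler_nat.
apply/bigop.bigmax_leqP => j jJ; apply: (bigop.bigmax_sup (s j)); first exact: sJ.
rewrite !countsE; apply: subset_leq_card; apply/fintype.subsetP => a.
by rewrite !inE ffunE => /andP[-> /eqP ->] /=.
Qed.

(** The columns of the particles of row i determine the column taken by row i,
    whereas the rest of the algorithm only looks at the other particles.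
    Redrawing the latter by mean_merge thus puts the rest of the algorithm in
    the situation of the induction hypothesis, with a fixed set of available
    columns.  The condition on cardinals guarantees that every row still has at
    least #|J| columns to choose from. *)
Lemma mean_greedy_ge g rs J J' : uniq rs -> (size rs + #|J| <= #|J'|)%N ->
  \sum_(i <- rs) mean (row_max g i J) <=
  mean (fun h => (greedy (counts g h) rs J')%:R : R).
Proof.
elim: rs J' => [|i rs IH] J' /=.
  by rewrite big_nil => _ _; rewrite /mean big1 ?mul0r// => h _.
move=> /andP[irs urs] szJ'.
have J'0 : (0 < #|J'|)%N by exact: leq_trans szJ'.
have T0 : (0 < #|{ffun 'I_m -> 'I_n}|)%N.
  by rewrite card_ffun expn_gt0 !card_ord (leq_ltn_trans (leq0n _) (ltn_ord i)).
rewrite big_cons.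
under [leRHS]eq_mean do rewrite natrD.
rewrite meanD lerD//.
  apply: (@le_trans _ _ (mean (row_max g i J'))).
    by apply: mean_row_max_le_card; apply: leq_trans szJ'; rewrite leq_addl.
  by apply: ler_mean => h; have [_ ->] := best_colP (counts g h) i J'0.
rewrite (mean_merge [set a | g a == i]%SET).
apply: mean_ge => // h.
have cin h' j : counts g (merge [set a | g a == i]%SET h h') (i, j) = counts g h (i, j).
  rewrite !countsE; apply: eq_card => a; rewrite !inE ffunE inE.
  by case: (g a == i).
have cout h' k j : k \in rs ->
    counts g (merge [set a | g a == i]%SET h h') (k, j) = counts g h' (k, j).
  move=> krs; rewrite !countsE; apply: eq_card => a; rewrite !inE ffunE inE.
  have [->|] := eqVneq (g a) k => //=.
  by have /negPf -> : k != i by apply: contraNneq irs => <-.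
under eq_mean do rewrite (eq_best_col J' (cin _)) (eq_greedy _ (cout _)).
apply: IH => //.
have [jJ' _] := best_colP (counts g h) i J'0.
by move: szJ'; rewrite [#|J'|](cardsD1 (best_col (counts g h) i J')) jJ'.
Qed.

(** This is mean_greedy_ge averaged over g.  The lower bound there is a sum of
    contributions of single rows, so the average over g turns each of them into
    the unconditioned average of a row maximum. *)
Lemma mean_max_assignment_ge J :
  \sum_(i in ~: J) mean (fun f : {ffun 'I_m -> 'I_n * 'I_n} =>
      (\max_(j in J) cell_counts f (i, j))%N%:R) <=
  mean (fun f : {ffun 'I_m -> 'I_n * 'I_n} =>
      (max_assignment (cell_counts f))%:R) :> R.
Proof.
rewrite mean_pair.
under eq_bigr do rewrite mean_pair.
rewrite -mean_sum; apply: ler_mean => g.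
rewrite -big_enum/=.
have sz : (size (enum (~: J)) + #|J| <= #|[set: 'I_n]%SET|)%N.
  by rewrite -cardE addnC cardsT cardsC.
apply: le_trans (mean_greedy_ge g (enum_uniq _) sz) _.
apply: ler_mean => h; rewrite ler_nat greedy_le_max_assignment ?enum_uniq//.
by apply: leq_trans sz; rewrite leq_addr.
Qed.

End GreedyMean.

(** * Moments of the cell counts *)

Section Fibers.
Variables (D C : finType).
Implicit Types (f : {ffun D -> C}) (c : C) (A B : {set D}).

Definition occupants f c : {set D} := [set a | f a == c]%SET.

Lemma card_family_prod (F : D -> pred C) : #|family F| = (\prod_a #|F a|)%N.
Proof. by rewrite card_family foldrE big_image. Qed.

Lemma card_occupants c A :
  #|[set f | occupants f c == A]%SET| = (#|C|.-1 ^ #|~: A|)%N.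
Proof.
have -> : #|[set f | occupants f c == A]%SET| =
    #|family (fun a => if a \in A then pred1 c else predC1 c)|.
  apply: eq_card => f; rewrite inE; apply/eqP/familyP => [<- a|fA].
    by rewrite inE; case: eqP => [->|/eqP fac]; rewrite inE.
  apply/setP => a; have := fA a; rewrite !inE; case: ifP => _; rewrite !inE => //.
  by move/negPf.
rewrite card_family_prod (bigID (mem A))/=.
rewrite big1 ?mul1n => [|a ->]; last by rewrite card1.
rewrite (eq_bigr (fun=> #|C|.-1)) => [|a /negPf ->]; last by rewrite cardC1.
rewrite prod_nat_const; congr expn.
by apply: eq_card => a; rewrite !inE.
Qed.

(** Only the particles outside A and B have a choice: any cell except c and
    c'. *)
Lemma card_occupants2 c c' A B : c != c' -> B \subset ~: A ->
  #|[set f | (occupants f c == A) && (occupants f c' == B)]%SET| =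
  ((#|C| - 2) ^ #|~: (A :|: B)|)%N.
Proof.
move=> cc' BA.
have -> : #|[set f | (occupants f c == A) && (occupants f c' == B)]%SET| =
    #|family (fun a => if a \in A then pred1 c else
                       if a \in B then pred1 c' else predC (pred2 c c'))|.
  apply: eq_card => f; rewrite inE.
  apply/andP/familyP => [[/eqP <- /eqP <-] a|fAB].
    rewrite !inE; have [->|fac] := eqVneq (f a) c; first by rewrite inE.
    by have [->|fac'] := eqVneq (f a) c'; rewrite !inE ?eqxx// negb_or fac.
  split; apply/eqP/setP => a; have := fAB a; rewrite !inE.
    case: ifP => aA; rewrite ?inE => //; case: ifP => aB; rewrite !inE.
      by move/eqP => ->; rewrite eq_sym (negPf cc').
    by rewrite negb_or => /andP[/negPf].
  case: ifP => aA; rewrite ?inE.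
    move/eqP => ->; rewrite (negPf cc').
    by apply/esym/negP => /(fintype.subsetP BA); rewrite inE aA.
  by case: ifP => _; rewrite !inE// negb_or => /andP[_ /negPf].
rewrite card_family_prod (bigID (mem (A :|: B)))/=.
rewrite big1 ?mul1n => [|a]; last first.
  by rewrite inE; case: ifP => _ /=; rewrite ?card1// => ->; rewrite card1.
rewrite (eq_bigr (fun=> #|C| - 2)%N) => [|a]; last first.
  rewrite inE negb_or => /andP[/negPf -> /negPf ->].
  by rewrite -(cardC (pred2 c c')) card2 cc' addKn.
rewrite prod_nat_const; congr expn.
by apply: eq_card => a; rewrite [LHS]unfold_in/= !inE.
Qed.

End Fibers.

Section Moments.
Variables (R : realFieldType) (m : nat) (C : finType).
Implicit Types (f : {ffun 'I_m -> C}) (c : C) (h : nat).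

Lemma cell_countsE f c : cell_counts f c = #|occupants f c|.
Proof. by rewrite ffunE. Qed.

Lemma card_cell_counts_eq c h :
  #|[set f : {ffun 'I_m -> C} | cell_counts f c == h]%SET| =
  ('C(m, h) * #|C|.-1 ^ (m - h))%N.
Proof.
rewrite -sum1_card.
rewrite (partition_big (fun f => occupants f c) (fun A => #|A| == h)) => [|f]/=;
  last by rewrite inE cell_countsE.
rewrite (eq_bigr (fun=> #|C|.-1 ^ (m - h)))%N => [|A /eqP Ah].
  rewrite sum_nat_const; congr muln.
  by rewrite -[in RHS](card_ord m) -card_draws; apply: eq_card => A; rewrite !inE.
rewrite -{1}Ah -[in RHS](card_ord m) -Ah -(cardsC A) addKn -(card_occupants c) -sum1_card.
apply: eq_bigl => f; rewrite !inE cell_countsE.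
by case: (occupants f c =P A) => [->|]; rewrite ?eqxx ?andbF.
Qed.

(** The exact count has 'C(m - h, h) in place of the second binomial
    coefficient. *)
Lemma card_cell_counts_eq2 c c' h : c != c' ->
  (#|[set f : {ffun 'I_m -> C} | (cell_counts f c == h) && (cell_counts f c' == h)]%SET|
   <= 'C(m, h) * 'C(m, h) * (#|C| - 2) ^ (m - 2 * h))%N.
Proof.
move=> cc'; rewrite -sum1_card.
rewrite (partition_big (fun f => (occupants f c, occupants f c'))
  (fun AB => (#|AB.1| == h) && ((AB.2 \subset ~: AB.1) && (#|AB.2| == h))))/=; last first.
  move=> f; rewrite inE !cell_countsE => /andP[-> ->]; rewrite andbT/=.
  by apply/fintype.subsetP => a; rewrite !inE => /eqP ->; rewrite eq_sym.
rewrite (eq_bigr (fun=> (#|C| - 2) ^ (m - 2 * h)))%N; last first.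
  case=> A B /= /and3P[/eqP Ah BA /eqP Bh].
  have -> : (m - 2 * h)%N = #|~: (A :|: B)|.
    apply/eqP; rewrite -(eqn_add2l #|A :|: B|) cardsC card_ord.
    rewrite cardsU Ah Bh.
    have -> : A :&: B = finset.set0.
      by rewrite finset.setIC; apply: disjoint_setI0; rewrite finset.disjoints_subset.
    have : (#|A| + #|B| <= #|'I_m|)%N.
      by rewrite -(cardsC A) leq_add2l subset_leq_card.
    by rewrite cards0 subn0 Ah Bh card_ord; lia.
  rewrite -(card_occupants2 cc' BA) -sum1_card.
  apply: eq_bigl => f; rewrite !inE !cell_countsE xpair_eqE.
  case: (occupants f c =P A) => [->|]; rewrite ?andbF//.
  by case: (occupants f c' =P B) => [->|]; rewrite ?andbF ?Ah ?Bh ?eqxx.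
rewrite sum_nat_const leq_mul2r; apply/orP; right.
rewrite -sum1_card -(pair_big_dep (fun A : {set 'I_m} => #|A| == h)
  (fun A B : {set 'I_m} => (B \subset ~: A) && (#|B| == h)) (fun _ _ => 1%N))/=.
rewrite (eq_bigr (fun=> 'C(m - h, h))) => [|A /eqP Ah]; last first.
  have -> : (m - h)%N = #|~: A|.
    by have := cardsC A; rewrite card_ord Ah; lia.
  rewrite -cards_draws -sum1_card.
  by apply: eq_bigl => B; rewrite inE.
rewrite sum_nat_const; apply: leq_mul.
  by rewrite -[in leqRHS](card_ord m) -card_draws; apply: subset_leq_card;
    apply/fintype.subsetP => A; rewrite !inE.
by rewrite leq_bin2l// leq_subr.
Qed.

(** The mass at h of the binomial law with m trials and success probability
    N^-1. *)
Definition binom_mass (N h : nat) : R :=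
  'C(m, h)%:R * N.-1%:R ^+ (m - h) / N%:R ^+ m.

Lemma mean_cell_counts_eq c h :
  mean (fun f => (cell_counts f c == h)%:R) = binom_mass #|C| h :> R.
Proof.
rewrite /mean /binom_mass card_ffun card_ord -!natrX -natrM.
rewrite -(card_cell_counts_eq c) -sum1_card natr_sum [in RHS]big_mkcond/=; congr (_ / _).
by apply: eq_bigr => f _; rewrite inE; case: eqP.
Qed.

(** The events that c, respectively c', holds exactly h particles are almost
    negatively correlated.  After cancelling the binomial coefficients, the
    claim reduces to (N - 2) N <= (N - 1)^2. *)
Lemma mean_cell_counts_eq2 c c' h : c != c' -> (2 * h <= m)%N ->
  mean (fun f => (cell_counts f c == h)%:R * (cell_counts f c' == h)%:R) <=
  (#|C|%:R / #|C|.-1%:R) ^+ (2 * h) * binom_mass #|C| h ^+ 2 :> R.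
Proof.
move=> cc' hm.
have N2 : (1 < #|C|)%N.
  by rewrite (cardD1 c) (cardD1 c') !inE eq_sym cc'.
have -> : mean (fun f => (cell_counts f c == h)%:R * (cell_counts f c' == h)%:R) =
    #|[set f : {ffun 'I_m -> C} |
        (cell_counts f c == h) && (cell_counts f c' == h)]%SET|%:R
      / #|C|%:R ^+ m :> R.
  rewrite /mean card_ffun card_ord natrX; congr (_ / _).
  rewrite -sum1_card natr_sum [RHS]big_mkcond/=; apply: eq_bigr => f _.
  by rewrite inE; case: eqP; case: eqP; rewrite ?mulr1 ?mulr0.
move: N2; move: (#|C|) (@card_cell_counts_eq2 c c' h cc') => N cardle N2.
set B : R := 'C(m, h)%:R.
have a0 : 0 < N.-1%:R :> R by rewrite ltr0n; lia.
have b0 : 0 < N%:R :> R by rewrite ltr0n; lia.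
apply: (@le_trans _ _ (B ^+ 2 * (N - 2)%:R ^+ (m - 2 * h) / N%:R ^+ m)).
  rewrite ler_wpM2r// ?invr_ge0 ?exprn_ge0//.
  by rewrite expr2 -natrX -!natrM ler_nat.
rewrite /binom_mass -/B; move: hm; set l := (m - 2 * h)%N => hm.
have -> : (m - h = l + h)%N by lia.
have mE : (m = l + 2 * h)%N by lia.
have key : (N - 2)%:R ^+ l * N%:R ^+ l <= N.-1%:R ^+ (2 * l) :> R.
  rewrite mulnC exprM -exprMn.
  have -> : N.-1%:R ^+ l ^+ 2 = (N.-1%:R ^+ 2) ^+ l :> R by rewrite -!exprM mulnC.
  rewrite lerXn2r ?nnegrE ?mulr_ge0 ?exprn_ge0// -natrM -natrX ler_nat; nia.
rewrite [in leLHS]mE.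
move: key a0 b0; set a : R := N.-1%:R; set b : R := N%:R; set e : R := (N - 2)%:R.
move=> key a0 b0.
have e2 (x : R) k : x ^+ (2 * k) = x ^+ k ^+ 2 by rewrite mulnC exprM.
have -> : (b / a) ^+ (2 * h) * (B * a ^+ (l + h) / b ^+ m) ^+ 2 =
   B ^+ 2 * (a ^+ (2 * l)) / b ^+ (2 * l + 2 * h).
  rewrite mE !e2 !exprD !expr0 !exprMn !exprVn.
  field; by rewrite !expf_neq0 ?gt_eqF.
have -> : B ^+ 2 * e ^+ l / b ^+ (l + 2 * h) =
   B ^+ 2 * (e ^+ l * b ^+ l) / b ^+ (2 * l + 2 * h).
  rewrite !exprD !expr0.
  field; by rewrite !expf_neq0 ?gt_eqF.
by rewrite ler_wpM2r ?invr_ge0 ?exprn_ge0 ?(ltW b0)// ler_wpM2l ?exprn_ge0.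
Qed.

(** Second moment method.  With Y the number of cells of S holding exactly h
    particles and t = (mean Y)^-1, the maximum is at least
    h (2 t Y - t^2 Y^2): the bracket is at most 1, and it vanishes if Y = 0.  The
    average of the bracket is at least 2 minus the bound on mean Y^2 divided
    by (mean Y)^2. *)
Lemma mean_bigmax_ge (S : {set C}) h :
  (2 * h <= m)%N -> (1 < #|C|)%N -> (0 < #|S|)%N ->
  h%:R * (2 - (#|C|%:R / #|C|.-1%:R) ^+ (2 * h)
          - (#|S|%:R * binom_mass #|C| h)^-1) <=
  mean (fun f => (\max_(c in S) cell_counts f c)%N%:R) :> R.
Proof.
move=> h2m N2 S0.
set q := binom_mass _ _; set r := _ ^+ (2 * h).
have q0 : 0 < q.
  rewrite /q /binom_mass divr_gt0 ?mulr_gt0 ?exprn_gt0 ?ltr0n ?bin_gt0//; lia.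
have S0R : 0 < #|S|%:R :> R by rewrite ltr0n.
have r0 : 0 <= r by rewrite exprn_ge0// divr_ge0.
pose Y f : R := \sum_(c in S) (cell_counts f c == h)%:R.
pose t : R := (#|S|%:R * q)^-1.
have t0 : 0 < t by rewrite invr_gt0 mulr_gt0.
have EY : mean Y = #|S|%:R * q.
  rewrite /Y mean_sum (eq_bigr (fun=> q)) => [|c _]; last exact: mean_cell_counts_eq.
  by rewrite sumr_const -[q *+ _]mulr_natl.
have EY2 : mean (fun f => Y f ^+ 2) <= #|S|%:R * q + r * (#|S|%:R * q) ^+ 2.
  under eq_mean => f.
    rewrite expr2 {1}/Y mulr_suml. under eq_bigr do rewrite /Y mulr_sumr. over.
  rewrite mean_sum; under eq_bigr do rewrite mean_sum.
  apply: (@le_trans _ _ (\sum_(c in S) (q + #|S|%:R * (r * q ^+ 2)))).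
    apply: ler_sum => c cS; rewrite (bigD1 c)//=; apply: lerD.
      rewrite /q -(mean_cell_counts_eq c h) le_eqVlt; apply/orP; left.
      by apply/eqP/eq_mean => f; case: eqP; rewrite ?mulr1 ?mulr0.
    apply: (@le_trans _ _ (\sum_(i in S | i != c) r * q ^+ 2)).
      apply: ler_sum => c' /andP[_ c'c]; apply: mean_cell_counts_eq2 => //.
      by rewrite eq_sym.
    rewrite sumr_const -[_ *+ _]mulr_natl ler_wpM2r ?mulr_ge0 ?exprn_ge0 ?(ltW q0)//.
    rewrite ler_nat; apply: subset_leq_card; apply/fintype.subsetP => x.
    by rewrite unfold_in => /andP[].
  rewrite sumr_const -[_ *+ _]mulr_natl le_eqVlt; apply/orP; left; apply/eqP.
  ring.
apply: (@le_trans _ _ (mean (fun f => h%:R * (2 * t * Y f + (- t ^+ 2) * Y f ^+ 2)))).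
  rewrite meanZ meanD !meanZ EY ler_wpM2l//.
  have tE : t * (#|S|%:R * q) = 1 by rewrite mulVf// gt_eqF// mulr_gt0.
  rewrite -mulrA tE mulr1.
  apply: (@le_trans _ _ (2 - t ^+ 2 * (#|S|%:R * q + r * (#|S|%:R * q) ^+ 2))).
    set w := #|S|%:R * q in tE *.
    have -> : t ^+ 2 * (w + r * w ^+ 2) = t * (t * w) + r * (t * w) ^+ 2 by ring.
    by rewrite tE -/t; lra.
  by rewrite mulNr lerD2l lerN2 ler_wpM2l// exprn_ge0// ltW.
apply: ler_mean => f.
have [/existsP[c /andP[cS /eqP ch]]|] :=
    boolP [exists c, (c \in S) && (cell_counts f c == h)].
  apply: (@le_trans _ _ (h%:R)).
    by rewrite ler_piMr//; have := sqr_ge0 (1 - t * Y f); nra.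
  by rewrite ler_nat -ch; exact: leq_bigmax_cond.
rewrite negb_exists => /forallP noh.
have -> : Y f = 0.
  rewrite /Y big1// => c cS; move: (noh c); rewrite cS/=.
  by case: eqP.
by rewrite expr0n/= !mulr0 addr0 mulr0.
Qed.

Lemma mean_expr_cell_counts (a : R) c :
  mean (fun f => a ^+ cell_counts f c) = ((a + #|C|.-1%:R) / #|C|%:R) ^+ m.
Proof.
rewrite /mean card_ffun card_ord natrX exprMn exprVn; congr (_ / _).
transitivity (\sum_(f : {ffun 'I_m -> C}) \prod_i (if f i == c then a else 1)).
  apply: eq_bigr => f _; rewrite -big_mkcond/= prodr_const cell_countsE.
  by congr (_ ^+ _); apply: eq_card => i; rewrite !inE.
rewrite -(bigA_distr_bigA (fun _ x => if x == c then a else 1)).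
rewrite prodr_const card_ord; congr (_ ^+ _).
rewrite (bigD1 c)//= eqxx; congr (_ + _).
rewrite (eq_bigr (fun=> 1)) => [|x /negPf -> //].
by rewrite sumr_const cardC1.
Qed.

End Moments.

(** * Expectations under the multinomial law *)

Section Expectation.
Context {R : realType} {d : measure_display} {T : measurableType d}.
Variables (P : probability T R) (m : nat) (C : finType).
Variable (X : C -> {RV P >-> nat}).

Definition count_vector (t : T) : {ffun C -> nat} := [ffun c => X c t].

Let A (k : {ffun C -> nat}) := [set t | forall c, X c t = k c].

Let inA k t : (t \in A k) = (k == count_vector t).
Proof.
apply/idP/eqP => [/set_mem At|->]; first by apply/ffunP => c; rewrite ffunE.
by apply/mem_set => c; rewrite ffunE.
Qed.

Let mA k : measurable (A k).
Proof.
have -> : A k = \bigcap_(c in [set: C]) (X c @^-1` [set k c]).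
  by apply/seteqP; split => [t At c _|t At c]; [exact: At|exact: At].
apply: fin_bigcap_measurable => [|c _]; first exact: finite_finset.
exact: measurable_funPTI.
Qed.

(** The count vector takes its values in a countable type, and its fibers are
    measurable, so any function of it is measurable. *)
Lemma measurable_count_vector (phi : {ffun C -> nat} -> R) :
  measurable_fun setT (phi \o count_vector).
Proof.
move=> _ Y _; rewrite setTI.
have -> : (phi \o count_vector) @^-1` Y =
    \bigcup_k (if phi k \in Y then A k else set0).
  apply/seteqP; split => t /=.
    move=> Yt; exists (count_vector t) => //; rewrite mem_set//.
    by apply/set_mem; rewrite inA.
  case=> k _; case: ifPn => // /set_mem Yk /mem_set; rewrite inA => /eqP <-.
  exact: Yk.
apply: countable_bigcupT_measurable => [|k]; first exact: countableP.
by case: ifP.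
Qed.

Hypotheses (X_law : has_multinomial_law m X) (C_gt0 : (0 < #|C|)%N).

Let s := undup [seq cell_counts f | f : {ffun 'I_m -> C}].

(** phi of the count vector, truncated to the finitely many vectors that m
    particles can realise. *)
Let G (phi : {ffun C -> nat} -> R) t : R := \sum_(k <- s) phi k * \1_(A k) t.

Let GE phi t :
  G phi t = if count_vector t \in s then phi (count_vector t) else 0.
Proof.
rewrite /G; under eq_bigr do rewrite indicE inA.
case: ifPn => gs.
  rewrite (bigD1_seq _ gs) ?undup_uniq//= eqxx mulr1 big1 ?addr0// => k /negPf ->.
  by rewrite mulr0.
rewrite big_seq big1// => k ks; case: eqP => [kg|]; last by rewrite mulr0.
by rewrite -kg ks in gs.
Qed.

Let integral_G phi : (forall k, 0 <= phi k) ->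
  (\int[P]_t (G phi t)%:E =
   (mean (fun f : {ffun 'I_m -> C} => phi (cell_counts f)))%:E)%E.
Proof.
move=> phi0; under eq_integral do rewrite /G -sumEFin.
rewrite ge0_integral_sum//; last 2 first.
- by move=> k; apply/measurable_EFinP/measurable_funM => //; exact: measurable_indic.
- by move=> k t _; rewrite lee_fin mulr_ge0// indicE.
transitivity (\sum_(k <- s) (phi k * multinomial_pmf R m k)%:E)%E.
  apply: eq_bigr => k _.
  under eq_integral do rewrite EFinM.
  rewrite ge0_integralZl//.
  - by rewrite integral_indic// setIT EFinM; congr (_ * _)%E; exact: X_law.
  - by apply/measurable_EFinP; exact: measurable_indic.
  - by rewrite lee_fin phi0.
rewrite sumEFin; congr EFin; rewrite /mean /multinomial_pmf card_ffun card_ord.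
under eq_bigr do rewrite mulrA.
rewrite -mulr_suml; congr (_ / _).
transitivity (\sum_(k <- s) \sum_(f : {ffun 'I_m -> C} | cell_counts f == k)
                phi (cell_counts f)).
  apply: eq_bigr => k _.
  rewrite (eq_bigr (fun=> phi k)) => [|f /eqP -> //].
  rewrite sumr_const -[RHS]mulr_natr; congr (_ * _%:R).
  by apply: eq_card => f; rewrite !inE.
under eq_bigr do rewrite big_mkcond.
rewrite exchange_big/=; apply: eq_bigr => f _.
have fs : cell_counts f \in s by rewrite mem_undup map_f// mem_enum.
rewrite (bigD1_seq _ fs) ?undup_uniq//= eqxx big1 ?addr0// => k.
by rewrite eq_sym => /negPf ->.
Qed.

(** The law gives the integral of the truncation G phi.  Applied to the
    constant 1, this shows that the realisable count vectors have total
    probability 1, so the truncation changes nothing almost everywhere. *)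
Lemma expectation_multinomial (phi : {ffun C -> nat} -> R) :
  (forall k, 0 <= phi k) ->
  'E_P[phi \o count_vector]%E =
  (mean (fun f : {ffun 'I_m -> C} => phi (cell_counts f)))%:E.
Proof.
move=> phi0; rewrite -integral_G// unlock.
have mG psi : measurable_fun setT (EFin \o G psi).
  rewrite (_ : G psi = (fun k => if k \in s then psi k else 0) \o count_vector).
    by apply/measurable_EFinP; exact: measurable_count_vector.
  by apply/funext => t; rewrite GE.
pose U := [set t | count_vector t \in s].
have mU : measurable U.
  have /(_ measurableT [set 1] (measurable_set1 _)) :=
    measurable_count_vector (fun k => (k \in s)%:R).
  rewrite setTI; congr measurable; apply/seteqP; split => t /=.
    by move=> /eqP; rewrite pnatr_eq1 eqb1.
  by move=> ->.
have PU : P U = 1%E.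
  rewrite -(setIT U) -integral_indic//.
  transitivity (\int[P]_t (G (fun=> 1) t)%:E)%E.
    apply: eq_integral => t _; rewrite GE indicE.
    by case: ifPn => gs; [rewrite mem_set | rewrite memNset//; exact/negP].
  rewrite integral_G// mean_const//.
  by rewrite card_ffun expn_gt0 C_gt0.
apply: ge0_ae_eq_integral => //.
- by apply/measurable_EFinP; exact: measurable_count_vector.
- exact: mG.
- by move=> t _; rewrite lee_fin phi0.
- by move=> t _; rewrite lee_fin GE; case: ifP.
exists (~` U); split; first exact: measurableC.
  by have := probability_setC P mU; rewrite PU subee.
move=> t /= FG Ut; apply: FG => _; rewrite GE.
by move: Ut; rewrite /U/= => ->.
Qed.

End Expectation.

(** * Upper bound *)

Section UpperBound.
Variable R : realType.

Definition mean_max_assignment (n m : nat) : R :=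
  mean (fun f : {ffun 'I_m -> 'I_n * 'I_n} => (max_assignment (cell_counts f))%:R).

(** Each entry y satisfies y <= t + exp (s (y - t)) / s, because
    1 + x <= exp x; the exponentials of the cells outside the assignment are
    positive and can be added. *)
Lemma max_assignment_le_expR (n : nat) (x : 'I_n * 'I_n -> nat) (s t : R) :
  0 < s ->
  (max_assignment x)%:R <=
  n%:R * t + s^-1 * expR (- (s * t)) * \sum_c expR s ^+ x c.
Proof.
move=> s0; rewrite /max_assignment.
have [|p ->] := bigop.eq_bigmax (fun p : 'S_n => \sum_(i < n) x (i, p i))%N.
  by apply/card_gt0P; exists 1%g.
set K := s^-1 * _.
have K0 : 0 <= K by rewrite mulr_ge0 ?invr_ge0 ?(ltW s0) ?expR_ge0.
have cell y : y%:R <= t + K * expR s ^+ y.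
  rewrite -expRM_natl -mulrA -expRD -lerBlDl mulrC ler_pdivlMr//.
  by apply: le_trans (expR_ge1Dx _); lra.
rewrite natr_sum; apply: (@le_trans _ _ (\sum_(i < n) (t + K * expR s ^+ x (i, p i)))).
  by apply: ler_sum => i _; exact: cell.
rewrite big_split/= sumr_const card_ord -[t *+ n]mulr_natl lerD2l.
rewrite -mulr_sumr ler_wpM2l//.
rewrite (eq_bigr (fun c => expR s ^+ x (c.1, c.2))); last by case.
rewrite -(pair_bigA _ (fun i j => expR s ^+ x (i, j)))/=; apply: ler_sum => i _.
by rewrite (bigD1 (p i))//= lerDl sumr_ge0// => j _; rewrite exprn_ge0 ?expR_ge0.
Qed.

Lemma mean_max_assignment_le (n m : nat) (s : R) : (0 < n)%N -> 0 < s ->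
  mean_max_assignment n m <=
  n%:R * ((ln n%:R + m%:R / n%:R ^+ 2 * expR s + 1) / s).
Proof.
move=> n0 s0; set L := ln _; set lam := _ / _.
have nR0 : 0 < n%:R :> R by rewrite ltr0n.
have N0 : (0 < n * n)%N by rewrite muln_gt0 n0.
(* This t makes exp (- s t) n^2 exp (lam exp s) equal to n. *)
pose t := (L + lam * expR s) / s.
apply: (@le_trans _ _ (mean (fun f : {ffun 'I_m -> 'I_n * 'I_n} =>
  n%:R * t + s^-1 * expR (- (s * t)) * \sum_c expR s ^+ cell_counts f c))).
  by apply: ler_mean => f; exact: max_assignment_le_expR.
rewrite meanD mean_const; last by rewrite card_ffun card_prod !card_ord expn_gt0 N0.
rewrite meanZ mean_sum.
have -> : n%:R * ((L + lam * expR s + 1) / s) = n%:R * t + s^-1 * n%:R.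
  by rewrite /t mulrDl mulrDr mul1r [n%:R / s]mulrC.
rewrite lerD2l -mulrA ler_wpM2l ?invr_ge0 ?(ltW s0)//.
under eq_bigr do rewrite mean_expr_cell_counts card_prod card_ord.
rewrite sumr_const cardT -cardE card_prod card_ord -[_ *+ _]mulr_natl.
have st : s * t = L + lam * expR s by rewrite /t mulrC divfK// gt_eqF.
have eL : expR L = n%:R by rewrite lnK// posrE.
have -> : n%:R = expR (- (s * t)) * ((n * n)%:R * expR (lam * expR s)) :> R.
  rewrite st opprD expRD expRN eL expRN natrM.
  by field; rewrite (gt_eqF nR0) gt_eqF// expR_gt0.
rewrite !ler_wpM2l ?expR_ge0//.
have NR0 : 0 < (n * n)%:R :> R by rewrite ltr0n.
apply: (@le_trans _ _ (expR (expR s / (n * n)%:R) ^+ m)).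
  rewrite lerXn2r ?nnegrE ?divr_ge0 ?addr_ge0 ?expR_ge0//.
  apply: le_trans (expR_ge1Dx _).
  rewrite mulrDl addrC lerD2r ler_pdivrMr// mul1r ler_nat; exact: leq_pred.
by rewrite -expRM_natl /lam natrM -expr2 mulrA mulrAC.
Qed.

End UpperBound.

(** * Lower bound *)

Section LowerBound.
Variable R : realType.

(** 'C(m, h) is the product of the h factors (m - i) / (h - i), each of which
    is at least m / h. *)
Lemma expn_le_bin (m h : nat) : (h <= m)%N -> (m ^ h <= 'C(m, h) * h ^ h)%N.
Proof.
elim: h m => [|h IH] [|m] hm //.
rewrite expnS [(h.+1 ^ h.+1)%N]expnS mulnA [('C(_, _) * _)%N]mulnC -mul_bin_diag/=.
rewrite -mulnA leq_mul2l/=.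
have [->|h0] := posnP h; first by rewrite bin0.
rewrite -(@leq_pmul2r (h ^ h)) ?expn_gt0 ?h0//.
apply: (@leq_trans (h.+1 ^ h * m ^ h)).
  by rewrite -!expnMn leq_exp2r//; lia.
by rewrite mulnAC [leqRHS]mulnC leq_mul2l IH ?orbT.
Qed.

Lemma pred_ratio_le (N : nat) : (1 < N)%N -> N%:R / N.-1%:R <= expR (2 / N%:R) :> R.
Proof.
case: N => [|[|N]]//= _; apply: le_trans (expR_ge1Dx _).
have N0 : 0 <= N%:R :> R by [].
rewrite ler_pdivrMr ?ltr0n// -[N.+2%:R]natr1 -[N.+1%:R]natr1.
rewrite mulrDl mul1r lerD2l mulrAC ler_pdivlMr; last by lra.
lra.
Qed.

(** The mass is at least (m / (N h))^h (1 - 1/N)^m, where the first factor is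
    at least exp (- u h) by the assumption on h, and the second one at least
    exp (- 2 m / N). *)
Lemma binom_mass_ge (N m h : nat) (u : R) :
  (1 < N)%N -> (h <= m)%N -> h%:R <= m%:R / N%:R * expR u ->
  expR (- (u * h%:R + 2 * (m%:R / N%:R))) <= binom_mass R m N h.
Proof.
move=> N1 hm hu; rewrite /binom_mass.
have N0 : 0 < N%:R :> R by rewrite ltr0n ltnW.
have M0 : 0 < N.-1%:R :> R by rewrite ltr0n; lia.
apply: (@le_trans _ _ ('C(m, h)%:R / N%:R ^+ h * (N.-1%:R / N%:R) ^+ m)); last first.
  have -> : 'C(m, h)%:R / N%:R ^+ h * (N.-1%:R / N%:R) ^+ m =
     'C(m, h)%:R * (N.-1%:R ^+ (m - h) * (N.-1%:R / N%:R) ^+ h) / N%:R ^+ m :> R.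
    have [l mE] : exists l, m = (l + h)%N by exists (m - h)%N; rewrite subnK.
    have -> : (m - h)%N = l by rewrite mE addnK.
    set B := 'C(m, h)%:R; rewrite mE !exprMn !exprVn !exprD.
    by field; rewrite !expf_neq0 ?gt_eqF.
  rewrite ler_wpM2r ?invr_ge0 ?exprn_ge0// ler_wpM2l// ler_piMr ?exprn_ge0//.
  rewrite exprn_ile1 ?divr_ge0// ler_pdivrMr// mul1r ler_nat; exact: leq_pred.
rewrite opprD expRD; apply: ler_pM; rewrite ?expR_ge0//.
  have [->|h0] := posnP h; first by rewrite mulr0 oppr0 expR0 bin0 divr1.
  have hR0 : 0 < h%:R :> R by rewrite ltr0n.
  rewrite ler_pdivlMr ?exprn_gt0// -(ler_pM2r (exprn_gt0 h hR0)).
  apply: (@le_trans _ _ (m%:R ^+ h)); last first.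
    by rewrite -!natrX -natrM ler_nat expn_le_bin.
  rewrite -mulNr [_ * h%:R]mulrC expRM_natl -!exprMn.
  rewrite lerXn2r ?nnegrE ?mulr_ge0 ?expR_ge0//.
  rewrite expRN -mulrA mulrC ler_pdivrMr ?expR_gt0//.
  by rewrite mulrC -ler_pdivlMr// mulrAC.
have -> : - (2 * (m%:R / N%:R)) = m%:R * - (2 / N%:R) :> R by rewrite mulrN mulrCA.
rewrite expRM_natl lerXn2r ?nnegrE ?expR_ge0 ?divr_ge0//.
rewrite expRN -[leRHS]invrK lef_pV2 ?posrE ?expR_gt0 ?invr_gt0 ?divr_gt0//.
by rewrite invf_div; exact: pred_ratio_le.
Qed.

(** J is the set of the first k columns, and the second moment method is
    applied in each of the other n - k rows. *)
Lemma mean_max_assignment_ge_moments (n m h k : nat) : (1 < n)%N -> (0 < k <= n)%N ->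
  (2 * h <= m)%N ->
  (n - k)%:R * (h%:R * (2 - expR (4 * h%:R / n%:R ^+ 2)
     - (k%:R * binom_mass R m (n ^ 2) h)^-1)) <= mean_max_assignment R n m.
Proof.
move=> n1 /andP[k0 kn] hm.
pose J := [set j : 'I_n | j < k]%N%SET.
have cJ : #|J| = k.
  rewrite -sum1_card (eq_bigl (fun j : 'I_n => (j < k)%N)) => [|j]; last by rewrite inE.
  by rewrite -(big_ord_widen n (fun=> 1%N)) // sum1_card card_ord.
have cJC : #|~: J| = (n - k)%N by have := cardsC J; rewrite cJ card_ord; lia.
apply: le_trans (mean_max_assignment_ge R m J).
rewrite -cJC mulr_natl -sumr_const; apply: ler_sum => i _.
pose S := [set (i, j) | j in J]%SET.
have inj : {in J &, injective (pair i)} by move=> j j' _ _ [].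
have cS : #|S| = k by rewrite card_in_imset.
have cN : #|{: 'I_n * 'I_n}| = (n ^ 2)%N by rewrite card_prod card_ord -mulnn.
have bm := @mean_bigmax_ge R m _ S h hm; rewrite cN cS in bm.
have N1 : (1 < n ^ 2)%N by rewrite -mulnn; nia.
apply: le_trans (le_trans (bm N1 k0) _).
  rewrite ler_wpM2l// lerD2r lerD2l lerN2.
  have -> : 4 * h%:R / n%:R ^+ 2 = (2 * h)%:R * (2 / (n ^ 2)%:R) :> R.
    by rewrite natrM natrX; ring.
  by rewrite expRM_natl lerXn2r ?nnegrE ?divr_ge0 ?expR_ge0// pred_ratio_le.
by apply: ler_mean => f; rewrite big_imset.
Qed.

Lemma mean_max_assignment_ge_expR (n m h k : nat) (u : R) :
  (1 < n)%N -> (0 < k <= n)%N -> (2 * h <= m)%N ->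
  h%:R <= m%:R / n%:R ^+ 2 * expR u ->
  (n - k)%:R * (h%:R * (2 - expR (4 * h%:R / n%:R ^+ 2)
     - expR (u * h%:R + 2 * (m%:R / n%:R ^+ 2)) / k%:R)) <=
  mean_max_assignment R n m.
Proof.
move=> n1 k0n hm hu; have /andP[k0 kn] := k0n.
have kR0 : 0 < k%:R :> R by rewrite ltr0n.
apply: le_trans (mean_max_assignment_ge_moments n1 k0n hm).
rewrite !ler_wpM2l// lerD2l lerN2 -natrX.
rewrite -[expR _ / _]invrK invf_div -expRN.
have N1 : (1 < n ^ 2)%N by rewrite -mulnn; nia.
have q : expR (- (u * h%:R + 2 * (m%:R / (n ^ 2)%:R))) <= binom_mass R m (n ^ 2) h.
  by apply: binom_mass_ge => //; [lia | rewrite natrX].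
have q0 : 0 < binom_mass R m (n ^ 2) h by apply: lt_le_trans q; exact: expR_gt0.
by rewrite lef_pV2 ?ler_pM2l// posrE pmulr_rgt0 ?expR_gt0.
Qed.

End LowerBound.

(** * Explicit two-sided estimates *)

Section Sandwich.
Variable R : realType.

(** The choice s = (1 - e) u in mean_max_assignment_le gives at most
    n (L / u) (1 + 2 e) / (1 - e). *)
Lemma mean_max_assignment_upper (n m : nat) (L u e : R) :
  (0 < n)%N -> 0 < e <= 1 / 4 -> L = ln n%:R -> 0 < u ->
  m%:R / n%:R ^+ 2 * expR u = L ->
  1 <= e * L -> expR (- (e * u)) <= e ->
  mean_max_assignment R n m <= n%:R * L / u * (1 + 7 * e).
Proof.
move=> n0 /andP[e0 e4] LE u0 lamE eL eu.
have s0 : 0 < (1 - e) * u by rewrite mulr_gt0//; lra.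
have L0 : 0 < L by rewrite -(pmulr_rgt0 _ e0); apply: lt_le_trans eL.
apply: le_trans (mean_max_assignment_le m n0 s0) _.
rewrite -LE.
have -> : n%:R * L / u * (1 + 7 * e) = n%:R * (L / u * (1 + 7 * e)) by rewrite !mulrA.
rewrite ler_wpM2l//.
have -> : m%:R / n%:R ^+ 2 * expR ((1 - e) * u) = L * expR (- (e * u)).
  by rewrite -lamE -[RHS]mulrA -expRD; congr (_ * expR _); ring.
rewrite ler_pdivrMr//.
have -> : L / u * (1 + 7 * e) * ((1 - e) * u) = L * (1 + 7 * e) * (1 - e).
  by field; rewrite gt_eqF.
have := ler_wpM2l (ltW L0) eu.
nra.
Qed.

(** The choice of h as the integer part of (1 - e) L / u, and of k just above
    e n.  Then u h <= (1 - e) L, so the expected number of cells with h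
    particles among k is at least e exp (e L - 2 lam), and the three factors
    n - k, h and the probability of success lose at most 1 - 2 e, 1 - 2 e and
    1 - e. *)
Lemma mean_max_assignment_lower (n m : nat) (L u e : R) :
  (1 < n)%N -> 0 < e <= 1 / 4 -> L = ln n%:R -> 1 <= u ->
  m%:R / n%:R ^+ 2 * expR u = L ->
  1 <= e * L -> expR (- u) <= e / 4 -> u <= e * L -> 1 <= e * n%:R ->
  expR (4 / n%:R) <= 1 + e / 2 -> expR (- (e * L / 2)) <= e ^+ 2 / 2 ->
  n%:R * L / u * (1 - 7 * e) <= mean_max_assignment R n m.
Proof.
move=> n1 /andP[e0 e4] LE u1 lamE eL eu uL en e4n eeL.
have n0 : 0 < n%:R :> R by rewrite ltr0n ltnW.
have L0 : 0 < L by rewrite -(pmulr_rgt0 _ e0); apply: lt_le_trans eL.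
have u0 : 0 < u by lra.
set lam := m%:R / n%:R ^+ 2 in lamE *.
have lamL : lam = L * expR (- u) by rewrite -lamE -mulrA -expRD subrr expR0 mulr1.
have Ln : L <= n%:R by rewrite LE ltW// ln_sublinear.
have eLn : expR L = n%:R by rewrite LE lnK// posrE.
pose h := Num.truncn ((1 - e) * (L / u)).
have K0 : 0 < L / u by rewrite divr_gt0.
have /andP[hle hgt] : h%:R <= (1 - e) * (L / u) < h.+1%:R.
  by apply: truncn_itv; rewrite mulr_ge0 ?(ltW K0)//; lra.
have eK : 1 <= e * (L / u) by rewrite mulrA ler_pdivlMr// mul1r.
have h2 : (1 - 2 * e) * (L / u) <= h%:R by move: hgt; rewrite -natr1; lra.
have uK : u * (L / u) = L by rewrite mulrC divfK// gt_eqF.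
have uh : u * h%:R <= (1 - e) * L.
  by rewrite -uK mulrCA ler_wpM2l// ltW.
have KL : L / u <= L by rewrite ler_pdivrMr//; nra.
have hL : h%:R <= L by nra.
pose k := (Num.truncn (e * n%:R)).+1.
have /andP[kge klt] : (k.-1)%:R <= e * n%:R < k%:R.
  by apply: truncn_itv; rewrite mulr_ge0 ?ltW.
have k2 : k%:R <= 2 * e * n%:R by move: kge; rewrite -[k%:R]natr1/=; lra.
have kn : (k <= n)%N by rewrite -(ler_nat R); nra.
have hm : (2 * h <= m)%N.
  rewrite -(ler_nat R) natrM.
  have mE : m%:R = lam * n%:R ^+ 2 by rewrite /lam divfK// expf_neq0// gt_eqF.
  (* m = lam n^2 = L exp (- u) n^2 >= L n >= 2 h. *)
  have ninv : n%:R^-1 <= expR (- u).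
    rewrite -eLn -expRN ler_expR; nra.
  have : L * n%:R^-1 <= lam by rewrite lamL ler_wpM2l// ltW.
  rewrite ler_pdivrMr// => Lln.
  have n2 : 2 <= n%:R :> R by rewrite ler_nat.
  rewrite mE expr2 mulrA; nra.
have hu : h%:R <= lam * expR u by rewrite lamE.
apply: le_trans (mean_max_assignment_ge_expR n1 (_ : 0 < k <= n)%N hm hu) => //.
rewrite -/lam.
have r1 : expR (4 * h%:R / n%:R ^+ 2) <= 1 + e / 2.
  apply: le_trans e4n; rewrite ler_expR expr2 invfM mulrA ler_wpM2r ?invr_ge0//.
  by rewrite ler_pdivrMr//; lra.
have r2 : expR (u * h%:R + 2 * lam) / k%:R <= e / 2.
  rewrite ler_pdivrMr; last by lra.
  apply: (@le_trans _ _ (e / 2 * (e * n%:R))); last by rewrite ler_wpM2l// ?ltW//; lra.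
  rewrite -eLn mulrA.
  apply: (@le_trans _ _ (expR (- (e * L / 2)) * expR L)); last first.
    by rewrite ler_wpM2r ?expR_ge0//; nra.
  rewrite -expRD ler_expR.
  have : lam <= L * (e / 4) by rewrite lamL ler_wpM2l// ltW.
  nra.
have nk : (1 - 2 * e) * n%:R <= (n - k)%:R by rewrite natrB//; lra.
rewrite -[X in X * _]mulrA.
apply: (@le_trans _ _ ((1 - 2 * e) * n%:R * ((1 - 2 * e) * (L / u) * (1 - e)))).
  have -> : (1 - 2 * e) * n%:R * ((1 - 2 * e) * (L / u) * (1 - e)) =
    n%:R * (L / u) * ((1 - 2 * e) ^+ 2 * (1 - e)) by ring.
  rewrite ler_wpM2l ?mulr_ge0 ?(ltW n0) ?(ltW K0)//; nra.
have e1 : 0 <= 1 - e by lra.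
have e2 : 0 <= 1 - 2 * e by lra.
have e2K : 0 <= (1 - 2 * e) * (L / u) by rewrite mulr_ge0// ltW.
apply: ler_pM nk _; rewrite ?(mulr_ge0 e2) ?(mulr_ge0 e2K)//.
by apply: ler_pM h2 _ => //; lra.
Qed.

End Sandwich.

(** * Asymptotics *)

Section Regime.
Variables (R : realType) (lam : nat -> R).
Hypothesis lam_gt0 : forall n, (2 <= n)%N -> 0 < lam n.

Lemma near_ln_ge (A : R) : \forall n \near \oo, A <= ln (n%:R : R).
Proof.
near=> n.
have An : expR A <= n%:R by near: n; exact: nbhs_infty_ger.
rewrite -[leLHS]expRK ler_ln ?posrE ?expR_gt0//.
by apply: lt_le_trans An; exact: expR_gt0.
Unshelve. all: by end_near. Qed.

Lemma near_log_ratio_ge (A : R) :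
  lam n / ln n%:R @[n --> \oo] --> (0 : R) ->
  \forall n \near \oo, A <= ln (ln n%:R / lam n).
Proof.
move=> /cvgr0Pnorm_le/(_ _ (expR_gt0 (- A))) lam0; near=> n.
have n2 : (2 <= n)%N by near: n; exact: nbhs_infty_ge.
have L0 : 0 < ln n%:R :> R.
  by apply: (@lt_le_trans _ _ 1) => //; near: n; exact: near_ln_ge.
have : `|lam n / ln n%:R| <= expR (- A).
  by near: n.
rewrite ger0_norm ?divr_ge0 ?(ltW L0) ?(ltW (lam_gt0 n2))// => lamA.
rewrite -[leLHS]expRK ler_ln ?posrE ?expR_gt0 ?divr_gt0 ?lam_gt0//.
rewrite -[leRHS]invrK invf_div -[expR A]invrK lef_pV2 ?posrE ?invr_gt0 ?expR_gt0//.
  by rewrite -expRN.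
by rewrite divr_gt0 ?lam_gt0.
Unshelve. all: by end_near. Qed.

(** Taking delta = e / 2 gives lam >= exp (- e L / 2) eventually, and the
    remaining factor L of L / lam is absorbed by another exp (e L / 2). *)
Lemma near_log_ratio_le (e : R) : 0 < e ->
  (forall delta : R, 0 < delta -> lam n * n%:R `^ delta @[n --> \oo] --> +oo) ->
  \forall n \near \oo, ln (ln n%:R / lam n) <= e * ln n%:R.
Proof.
move=> e0 lamy; have e20 : 0 < e / 2 by lra.
near=> n.
have n2 : (2 <= n)%N by near: n; exact: nbhs_infty_ge.
set L := ln n%:R.
have L1 : 1 <= L by rewrite /L; near: n; exact: near_ln_ge.
have L0 : 0 < L by lra.
have LA : 16 / e ^+ 2 <= L by rewrite /L; near: n; exact: near_ln_ge.
have lamn : 1 <= lam n * n%:R `^ (e / 2).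
  by near: n; move/cvgryPge: (lamy _ e20); exact.
rewrite -[leRHS]expRK ler_ln ?posrE ?expR_gt0 ?divr_gt0 ?lam_gt0//.
rewrite ler_pdivrMr ?lam_gt0//.
rewrite /powR pnatr_eq0 gtn_eqF ?(ltnW n2)// -/L in lamn.
(* exp (2 x) >= x^2 with x = e L / 4, and x^2 >= L once L >= 16 / e^2. *)
have Lexp : L <= expR (e / 2 * L).
  have -> : e / 2 * L = 2%:R * (e / 4 * L) by field.
  rewrite expRM_natl; have := expR_ge1Dx (e / 4 * L).
  move: LA; rewrite ler_pdivrMr ?exprn_gt0// => LA x1.
  have x0 : 0 < e / 4 * L by rewrite mulr_gt0//; lra.
  apply: (@le_trans _ _ ((e / 4 * L) ^+ 2)).
    have -> : (e / 4 * L) ^+ 2 = L * (L * e ^+ 2) / 16 by field.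
    by rewrite ler_pdivlMr// ler_wpM2l// ltW.
  by rewrite lerXn2r ?nnegrE ?(ltW x0) ?expR_ge0//; lra.
have -> : e * L = e / 2 * L + e / 2 * L by field.
rewrite expRD -[leRHS]mulrA -[leLHS]mulr1; apply: ler_pM => //; first exact: ltW.
by rewrite mulrC.
Unshelve. all: by end_near. Qed.

End Regime.

Section Asymptotics.
Variables (R : realType) (m : nat -> nat).
Hypothesis m_gt0 : forall n, (2 <= n)%N -> (0 < m n)%N.
Let lam n : R := (m n)%:R * n%:R ^- 2.
Let target n : R := n%:R * ln n%:R / ln (ln n%:R / lam n).

Lemma near_mean_max_assignment (e : R) : 0 < e <= 1 / 4 ->
  lam n / ln n%:R @[n --> \oo] --> (0 : R) ->
  (forall delta : R, 0 < delta -> lam n * n%:R `^ delta @[n --> \oo] --> +oo) ->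
  \forall n \near \oo, 0 < target n /\
    target n * (1 - 7 * e) <= mean_max_assignment R n (m n) <=
    target n * (1 + 7 * e).
Proof.
move=> /[dup] e14 /andP[e0 e4] lam0 lamy.
have lam_gt0 n : (2 <= n)%N -> 0 < lam n.
  move=> n2; rewrite divr_gt0 ?exprn_gt0 ?ltr0n ?m_gt0//; exact: ltnW.
have [e20 ei0] : 0 < e / 2 /\ 0 < e^-1 by rewrite divr_gt0 ?invr_gt0.
have small (x y : R) : 0 < y -> - ln y <= x -> expR (- x) <= y.
  by move=> y0 xy; rewrite -[leRHS]lnK ?posrE// ler_expR lerNl.
near=> n.
have n2 : (1 < n)%N by near: n; exact: nbhs_infty_ge.
have n0 : 0 < n%:R :> R by rewrite ltr0n ltnW.
have L1 : 1 <= ln n%:R :> R by near: n; exact: near_ln_ge.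
have Le : e^-1 <= ln n%:R :> R by near: n; exact: near_ln_ge.
have Ls : - ln (e ^+ 2 / 2) / (e / 2) <= ln n%:R :> R by near: n; exact: near_ln_ge.
have u1 : 1 <= ln (ln n%:R / lam n) by near: n; exact: near_log_ratio_ge.
have ue : - ln e / e <= ln (ln n%:R / lam n) by near: n; exact: near_log_ratio_ge.
have ue4 : - ln (e / 4) <= ln (ln n%:R / lam n) by near: n; exact: near_log_ratio_ge.
have uL : ln (ln n%:R / lam n) <= e * ln n%:R by near: n; exact: near_log_ratio_le.
have en : e^-1 <= n%:R by near: n; exact: nbhs_infty_ger.
have n4 : 4 / ln (1 + e / 2) <= n%:R by near: n; exact: nbhs_infty_ger.
rewrite /target; set L := ln n%:R in L1 Le Ls u1 ue ue4 uL *.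
set u := ln (L / lam n) in u1 ue ue4 uL *.
have [L0 u0] : 0 < L /\ 0 < u by lra.
have lamE : (m n)%:R / n%:R ^+ 2 * expR u = L.
  have l0 : 0 < lam n by apply/lam_gt0.
  have -> : expR u = L / lam n by rewrite lnK// posrE divr_gt0.
  by rewrite -/(lam n) mulrC divfK// gt_eqF.
have eL : 1 <= e * L by rewrite -ler_pdivrMl// mulr1.
have eu : expR (- (e * u)) <= e.
  by apply: small => //; rewrite mulrC -ler_pdivrMr.
split; first by rewrite divr_gt0 ?mulr_gt0.
apply/andP; split; last by apply: mean_max_assignment_upper => //; exact: ltnW.
apply: mean_max_assignment_lower => //.
- by apply: small => //; lra.
- by rewrite -ler_pdivrMl// mulr1.
- have l0 : 0 < ln (1 + e / 2) by rewrite ln_gt0//; lra.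
  rewrite -[leRHS]lnK ?posrE; last lra.
  by rewrite ler_expR ler_pdivrMr// mulrC -ler_pdivrMr.
- apply: small; first by rewrite divr_gt0// exprn_gt0.
  have -> : e * L / 2 = L * (e / 2) by field.
  by rewrite -ler_pdivrMr.
Unshelve. all: by end_near. Qed.

End Asymptotics.

Theorem theorem5 (R : realType) (m : nat -> nat)
    (m_gt0 : forall n : nat, (2 <= n)%N -> (0 < m n)%N)
    (d : nat -> measure_display)
    (T : forall n : nat, measurableType (d n))
    (P : forall n : nat, probability (T n) R)
    (X : forall n : nat, 'I_n * 'I_n -> {RV (P n) >-> nat})
    (X_law : forall n : nat, (2 <= n)%N -> has_multinomial_law (m n) (@X n)) :
  let p : nat -> R := fun n => n%:R ^- 2 in
  let mp : nat -> R := fun n => (m n)%:R * p n in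
  (mp n / ln n%:R @[n --> \oo] --> (0 : R)) ->
  (forall delta : R, 0 < delta -> mp n * n%:R `^ delta @[n --> \oo] --> +oo) ->
  exists2 eps : nat -> R,
    eps n @[n --> \oo] --> (0 : R) &
    \forall n \near \oo,
      'E_(P n)[fun t : T n => (max_assignment (fun c => X n c t))%:R]%E =
      (n%:R * ln n%:R / ln (ln n%:R / mp n) * (1 + eps n))%:E.
Proof.
move=> p mp mp0 mpy.
pose target n : R := n%:R * ln n%:R / ln (ln n%:R / mp n).
exists (fun n => mean_max_assignment R n (m n) / target n - 1).
  apply/cvgr0Pnorm_le => e e0.
  pose e' := Num.min (1 / 4) (e / 7).
  have e'14 : 0 < e' <= 1 / 4 by rewrite lt_min ge_min lexx !divr_gt0.
  have e'e : 7 * e' <= e.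
    have : e' <= e / 7 by rewrite ge_min lexx orbT.
    lra.
  near=> n.
  have : 0 < target n /\ target n * (1 - 7 * e') <= mean_max_assignment R n (m n) <=
      target n * (1 + 7 * e').
    by near: n; exact: near_mean_max_assignment.
  move=> [t0 /andP[lo hi]].
  rewrite ler_norml lerBrDr lerBlDr ler_pdivlMr// ler_pdivrMr//.
  apply/andP; split; [apply: le_trans lo | apply: le_trans hi _].
    by rewrite mulrC ler_wpM2l ?(ltW t0)//; lra.
  by rewrite [leRHS]mulrC ler_wpM2l ?(ltW t0)//; lra.
near=> n.
have n2 : (2 <= n)%N by near: n; exact: nbhs_infty_ge.
have [t0 _] : 0 < target n /\
    target n * (1 - 7 * (1 / 4)) <= mean_max_assignment R n (m n) <=
    target n * (1 + 7 * (1 / 4)).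
  by near: n; apply: near_mean_max_assignment => //; rewrite lexx divr_gt0.
rewrite -/(target n) addrC subrK mulrC divfK ?gt_eqF//.
have -> : (fun t : T n => (max_assignment (fun c => X n c t))%:R : R) =
    (fun k : {ffun 'I_n * 'I_n -> nat} => (max_assignment k)%:R) \o
      count_vector (@X n).
  apply/funext => t /=; congr (max_assignment _)%:R.
  by apply/funext => c; rewrite ffunE.
apply: (expectation_multinomial (X_law n n2)) => //.
by rewrite card_prod card_ord muln_gt0 ltnW.
Unshelve. all: by end_near. Qed.
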